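(* There exists a linear-time (i.e., $O(|V|+|E|)$) algorithm that decides, for a given weighted graph $(G=(V,E),\omega)$, whether it is level-split, i.e., whether all its level graphs are split graphs.
   Context: A weighted graph is a pair $(G,\omega)$ with $G$ finite simple undirected and $\omega:E(G)\to\{1,\dots,k\}$ surjective for some $k\ge1$. For $1\le i\le k+1$ the $i$-th level graph is obtained from $G$ by removing all edges $e$ with $\omega(e)<i$. A split graph is a graph whose vertex set can be partitioned into a clique and an independent set. *)

(* Defs.v *)
From mathcomp Require Import all_boot all_order.
Set Implicit Arguments. Unset Strict Implicit. Unset Printing Implicit Defensive.

(* w   : edge weights (only the values on edges matter; w is read as   *)
(*       a function of the unordered pair, hence required symmetric    *)
(*       on edges);  w maps E(G) ONTO {1,...,k} for some k >= 1.        *)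

Definition simple_graph (n : nat) (adj : rel 'I_n) : Prop :=
  irreflexive adj /\ symmetric adj.

Definition weighted_graph (n : nat) (adj : rel 'I_n) (w : 'I_n -> 'I_n -> nat)
    (k : nat) : Prop :=
  [/\ simple_graph adj,
      1 <= k,
      (forall x y, adj x y -> w x y = w y x),
      (forall x y, adj x y -> 1 <= w x y <= k) &
      (forall i, 1 <= i <= k -> exists x y, adj x y /\ w x y = i)].

Definition level_graph (n : nat) (adj : rel 'I_n) (w : 'I_n -> 'I_n -> nat)
    (i : nat) : rel 'I_n :=
  fun x y => adj x y && (i <= w x y).

Definition is_clique (n : nat) (adj : rel 'I_n) (K : {set 'I_n}) : Prop :=
  forall x y, x \in K -> y \in K -> x != y -> adj x y.

Definition is_independent (n : nat) (adj : rel 'I_n) (I : {set 'I_n}) : Prop :=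
  forall x y, x \in I -> y \in I -> ~~ adj x y.

Definition split_graph (n : nat) (adj : rel 'I_n) : Prop :=
  exists K : {set 'I_n}, is_clique adj K /\ is_independent adj (~: K).

Definition level_split (n : nat) (adj : rel 'I_n) (w : 'I_n -> 'I_n -> nat)
    (k : nat) : Prop :=
  forall i, 1 <= i <= k.+1 -> split_graph (level_graph adj w i).

(* Input encoding: an edge list.  s lists every edge exactly once, as  *)
(* a triple (u, v, c) with endpoints u, v (in either orientation) and  *)
(* its weight c.  Size of the input: |V| + |E| = n + size s.           *)

Definition upair (e : nat * nat * nat) : nat * nat :=
  let: (u, v, _) := e in (minn u v, maxn u v).

Definition encodes (n : nat) (adj : rel 'I_n) (w : 'I_n -> 'I_n -> nat)
    (s : seq (nat * nat * nat)) : Prop :=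
  [/\ uniq (map upair s),
      (forall u v c, (u, v, c) \in s ->
         exists (x y : 'I_n), [/\ nat_of_ord x = u, nat_of_ord y = v,
                                 adj x y & w x y = c]) &
      (forall x y : 'I_n, adj x y ->
         exists c, ((nat_of_ord x, nat_of_ord y, c) \in s) \/
                   ((nat_of_ord y, nat_of_ord x, c) \in s))].

(* Machine model: unit-cost random access machine with natural-number  *)
(* registers and memory cells, instructions: constant load, addition,  *)
(* truncated subtraction, indirect load/store, conditional and         *)
(* unconditional jumps, halt.  Each executed instruction costs 1.      *)

Inductive instr : Type :=
  | IConst of nat & nat
  | IAdd of nat & nat & nat
  | ISub of nat & nat & nat
  | ILoad of nat & nat
  | IStore of nat & nat
  | IJz of nat & nat
  | IJmp of nat
  | IHalt.                       (* stop (also: pc outside the program)   *)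

Record mstate : Type := MState {
  pc : nat; regs : nat -> nat; mem : nat -> nat }.

Definition upd (f : nat -> nat) (a v : nat) : nat -> nat :=
  fun x => if x == a then v else f x.

Definition step (p : seq instr) (st : mstate) : option mstate :=
  let: MState i R M := st in
  match nth IHalt p i with
  | IConst r c => Some (MState i.+1 (upd R r c) M)
  | IAdd r a b => Some (MState i.+1 (upd R r (R a + R b)) M)
  | ISub r a b => Some (MState i.+1 (upd R r (R a - R b)) M)
  | ILoad r a => Some (MState i.+1 (upd R r (M (R a))) M)
  | IStore a b => Some (MState i.+1 R (upd M (R a) (R b)))
  | IJz r l => Some (MState (if R r == 0 then l else i.+1) R M)
  | IJmp l => Some (MState l R M)
  | IHalt => None
  end.

Fixpoint run (p : seq instr) (t : nat) (st : mstate) : option mstate :=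
  match step p st with
  | None => Some st
  | Some st' => if t is t'.+1 then run p t' st' else None
  end.

(* initial memory: M[0] = n, M[1] = |E|, then the triples (u,v,c) of s
   at addresses 2+3j, 3+3j, 4+3j; all other cells and registers are 0 *)
Definition input_mem (n : nat) (s : seq (nat * nat * nat)) : nat -> nat :=
  fun a =>
    if a == 0 then n else if a == 1 then size s else
    let j := (a - 2) %/ 3 in
    if j < size s then
      let: (u, v, c) := nth (0, 0, 0) s j in
      let r := (a - 2) %% 3 in
      if r == 0 then u else if r == 1 then v else c
    else 0.

Definition init_state (n : nat) (s : seq (nat * nat * nat)) : mstate :=
  MState 0 (fun _ => 0) (input_mem n s).

(* Main.v *)
Require Import Defs.
From mathcomp Require Import all_boot all_order.
From mathcomp Require Import zify.
Set Implicit Arguments. Unset Strict Implicit. Unset Printing Implicit Defensive.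

(* A vertex set [K] of a graph with degrees [d] satisfies
   [sum_(x in K) d x <= |E| + 'C(|K|, 2)], with equality exactly when [K] is a clique
   with independent complement.  Maximising [sum_(x in K) d x - 'C(|K|, 2)] over [K]
   gives the number [T] of cells on or above the diagonal of the Young diagram of the
   degree sequence, i.e. [T = sum_(j >= 1) min(c_j, j)] with [c_j] the number of
   vertices of degree at least [j]; hence the graph is split iff [|E| <= T].
   When a degree grows from [j - 1] to [j], [T] grows by one iff [c_j < j], so [T] is
   maintained in constant time while the edges are inserted by decreasing weight.
   The weights are at most [|E|] by surjectivity, so a bucket sort finds this order. *)

(** * Layers and corner of a degree function *)

Definition num_ge (T : finType) (d : T -> nat) (j : nat) : nat :=
  #|[set x | j <= d x]|.

(* The cutoff [N] is immaterial as soon as it exceeds all values of [d]. *)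
Definition corner (T : finType) (N : nat) (d : T -> nat) : nat :=
  \sum_(1 <= j < N) minn (num_ge d j) j.

Lemma eq_corner (T : finType) (N : nat) (d d' : T -> nat) :
  d =1 d' -> corner N d = corner N d'.
Proof.
move=> dd'; apply: eq_bigr => j _; congr minn.
by apply: eq_card => x; rewrite !inE dd'.
Qed.

Lemma sum_leq_nat (N d : nat) : d < N -> \sum_(1 <= j < N) (j <= d) = d.
Proof.
move=> dN; rewrite (big_cat_nat (n := d.+1)) //=.
rewrite [X in _ + X]big_nat_cond [X in _ + X]big1; last first.
  by move=> j /andP[/andP[dj _] _]; rewrite leqNgt dj.
rewrite addn0 big_nat_cond (eq_bigr (fun=> 1)) => [|j /andP[/andP[_ jd] _]]; last first.
  by rewrite -ltnS jd.
by rewrite -big_nat_cond sum_nat_const_nat muln1 subn1.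
Qed.

Lemma sum_subn_bin2 (N m : nat) : m <= N -> \sum_(1 <= j < N) (m - j) = 'C(m, 2).
Proof.
elim: m => [|m IHm] mN; first by rewrite big1.
rewrite binS bin1 -(IHm (ltnW mN)) -[X in _ = _ + X](sum_leq_nat mN) -big_split /=.
by apply: eq_bigr => j _; lia.
Qed.

Lemma num_ge_bump (T : finType) (d d' : T -> nat) (v : T) (j : nat) :
    (forall x, d' x = d x + (x == v)) ->
  num_ge d' j = num_ge d j + (j == (d v).+1).
Proof.
move=> d'E; have [->|neq] := eqVneq j (d v).+1.
  rewrite /num_ge addn1 (_ : [set x | _ <= d' x] = v |: [set x | d v < d x]).
    by rewrite cardsU1 inE ltnn.
  apply/setP => x; rewrite !inE d'E; have [->|_] := eqVneq x v; first by lia.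
  by rewrite addn0.
rewrite addn0; apply: eq_card => x; rewrite !inE d'E.
by have [->|_] := eqVneq x v; lia.
Qed.

Section Corner.
Variables (T : finType) (N : nat) (d : T -> nat).
Hypothesis dN : forall x, d x < N.

Lemma sum_layers (K : {set T}) :
  \sum_(x in K) d x = \sum_(1 <= j < N) #|K :&: [set x | j <= d x]|.
Proof.
rewrite (eq_bigr (fun x => \sum_(1 <= j < N) (j <= d x))); last first.
  by move=> x _; rewrite sum_leq_nat.
rewrite exchange_big /=; apply: eq_bigr => j _.
rewrite -sum1_card [RHS](eq_bigl (fun x => (x \in K) && (j <= d x))) => [|x]; last first.
  by rewrite !inE.
by rewrite big_mkcondr; apply: eq_bigr => x _; case: leqP.
Qed.

(** With [L_j] the vertices of value at least [j], [|K :&: L_j| <= min(c_j, |K|) <= min(c_j, j) +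
    (|K| - j)], and the truncated differences sum to ['C(|K|, 2)]. *)
Lemma sum_leq_corner (K : {set T}) : #|K| <= N ->
  \sum_(x in K) d x <= corner N d + 'C(#|K|, 2).
Proof.
move=> KN; rewrite sum_layers -(sum_subn_bin2 KN) -big_split /=.
apply: leq_sum => j _.
have := subset_leq_card (subsetIl K [set x | j <= d x]).
have := subset_leq_card (subsetIr K [set x | j <= d x]).
rewrite /num_ge; lia.
Qed.

Lemma set_between (A B : {set T}) (m : nat) : A \subset B -> #|A| <= m <= #|B| ->
  exists K : {set T}, [/\ A \subset K, K \subset B & #|K| = m].
Proof.
move=> AB /andP[]; elim: m => [|m IHm].
  by rewrite leqn0 => /eqP A0 _; exists A.
rewrite leq_eqVlt => /predU1P[<- _|]; first by exists A.
rewrite ltnS => Am mB; have [K [AK KB Km]] := IHm Am (ltnW mB).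
have /set0Pn[x] : B :\: K != set0.
  by rewrite -card_gt0 cardsD (setIidPr KB) Km subn_gt0.
rewrite inE => /andP[xK xB]; exists (x |: K); split.
- by rewrite (subset_trans AK) // subsetU1.
- by rewrite subUset sub1set xB.
- by rewrite cardsU1 xK Km.
Qed.

(* The optimal set consists of the [m] vertices of largest value, where [m] is the
   side of the Durfee square of the partition with parts [d x]. *)
Lemma corner_leq_sum :
  exists K : {set T}, corner N d + 'C(#|K|, 2) <= \sum_(x in K) d x.
Proof.
have ex0 : exists m, m <= num_ge d m by exists 0.
have ub m : m <= num_ge d m -> m <= #|T| by move/leq_trans; apply; exact: max_card.
have [m mm max_m] := ex_maxnP ex0 ub.
have gtm : num_ge d m.+1 <= m.
  by rewrite -ltnS ltnNge; apply/negP => /max_m; rewrite ltnn.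
have [||K [AK KB Km]] := @set_between [set x | m < d x] [set x | m <= d x] m.
- by apply/subsetP => x; rewrite !inE => /ltnW.
- by rewrite gtm mm.
have mN : m <= N.
  case: (posnP m) => [->//|m0].
  have /card_gt0P[x] := leq_trans m0 mm.
  by rewrite inE => /leq_trans/(_ (ltnW (dN x))).
exists K; rewrite sum_layers Km -(sum_subn_bin2 mN) -big_split /=.
(* Layers up to [m] contain [K] and contribute [m = j + (m - j)]; the higher ones lie inside [K] and
   contribute all of [c_j]. *)
apply: leq_sum => j _; case: (leqP j m) => jm.
  rewrite (setIidPl _) ?Km; first by lia.
  by apply: subset_trans KB _; apply/subsetP => x; rewrite !inE; apply: leq_trans.
rewrite (setIidPr _); first by rewrite /num_ge; lia.
by apply: subset_trans _ AK; apply/subsetP => x; rewrite !inE; apply: leq_trans.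
Qed.

Lemma corner_bump (d' : T -> nat) (v : T) : (d v).+1 < N ->
    (forall x, d' x = d x + (x == v)) ->
  corner N d' = corner N d + (num_ge d (d v).+1 < (d v).+1).
Proof.
move=> vN d'E; have num_geE := num_ge_bump _ d'E.
rewrite /corner (bigD1_seq (d v).+1) ?mem_index_iota ?iota_uniq //=.
rewrite [in RHS](bigD1_seq (d v).+1) ?mem_index_iota ?iota_uniq //=.
under eq_bigr => j /negbTE jv do rewrite num_geE jv addn0.
by rewrite num_geE eqxx; lia.
Qed.
End Corner.

(** * Split graphs through their degrees *)

Section SplitDegrees.
Variables (n : nat) (adj : rel 'I_n).
Hypothesis adjP : simple_graph adj.

Definition degree (x : 'I_n) : nat := #|[set y | adj x y]|.

Definition num_arcs (A B : {set 'I_n}) : nat :=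
  \sum_(x in A) \sum_(y in B) adj x y.

Lemma sum_degree (A K : {set 'I_n}) :
  \sum_(x in A) degree x = num_arcs A K + num_arcs A (~: K).
Proof.
rewrite -big_split /=; apply: eq_bigr => x _.
rewrite /degree -sum1_card big_mkcond (bigID (mem K)) /=.
congr (_ + _); first by apply: eq_bigr => y _; rewrite inE; case: adj.
by apply: eq_big => [y|y _]; rewrite inE //; case: adj.
Qed.

Lemma num_arcsC (A B : {set 'I_n}) : num_arcs A B = num_arcs B A.
Proof.
rewrite /num_arcs exchange_big; apply: eq_bigr => y _; apply: eq_bigr => x _.
by rewrite adjP.2.
Qed.

Lemma num_arcs_leq (K : {set 'I_n}) : num_arcs K K <= #|K| * #|K|.-1 ?= iff
  [forall x in K, forall y in K, (x != y) ==> adj x y].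
Proof.
have -> : #|K| * #|K|.-1 = \sum_(x in K) \sum_(y in K) (x != y).
  rewrite -sum_nat_const; apply: eq_bigr => x xK.
  rewrite (cardsD1 x K) xK /= -sum1_card big_mkcond [RHS]big_mkcond.
  by apply: eq_bigr => y _; rewrite !inE eq_sym; case: eqVneq; case: (y \in K).
apply: leqif_sum => x _; apply: leqif_sum => y _.
by have := adjP.1 x; case: eqVneq => [<- ->|_ _] /=; split=> //; case: adj.
Qed.

(** With [a], [b], [i] the arcs inside [K], from [K] to its complement, and inside the complement,
    the inequality reads [a + 2b + i + q <= 2a + 2b] for [q = |K|(|K| - 1)]. As [a <= q], it forces
    [a = q] and [i = 0]. *)
Lemma sum_degree_split (K : {set 'I_n}) :
  \sum_x degree x + #|K| * #|K|.-1 <= (\sum_(x in K) degree x).*2 <->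
  is_clique adj K /\ is_independent adj (~: K).
Proof.
have -> : \sum_x degree x = \sum_(x in K) degree x + \sum_(x in ~: K) degree x.
  rewrite (bigID (mem K)) /=; congr (_ + _).
  by apply: eq_bigl => x; rewrite inE.
rewrite !(sum_degree _ K) (num_arcsC (~: K) K) -addnn.
have [le_arcs eq_arcs] := num_arcs_leq K.
set a := num_arcs K K in le_arcs eq_arcs *; set i := num_arcs (~: K) _.
set b := num_arcs K _.
have indP : i = 0 <-> is_independent adj (~: K).
  rewrite /i /num_arcs; split=> [/eqP|indK].
    rewrite sum_nat_eq0 => /forall_inP i0 x y xK yK.
    by have := i0 x xK; rewrite sum_nat_eq0 => /forall_inP/(_ y yK); case: adj.
  by rewrite big1 // => x xK; rewrite big1 // => y yK; rewrite (negbTE (indK _ _ xK yK)).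
have clqP : a = #|K| * #|K|.-1 <-> is_clique adj K.
  rewrite (rwP eqP) eq_arcs; split=> [/forall_inP cl x y xK yK|cl].
    by move/forall_inP: (cl x xK) => /(_ y yK)/implyP.
  apply/forall_inP => x xK; apply/forall_inP => y yK.
  by apply/implyP; apply: cl.
rewrite -indP -clqP; move: le_arcs; move: (#|K| * _) => q; lia.
Qed.

(* The splittance criterion of Hammer and Simeone, in conjugate-partition form. *)
Theorem split_graph_corner (N : nat) : n <= N -> (forall x, degree x < N) ->
  split_graph adj <-> \sum_x degree x <= (corner N degree).*2.
Proof.
move=> nN dN.
have bin2E m : 'C(m, 2).*2 = m * m.-1.
  by rewrite bin2 -[RHS]odd_double_half; case: m => // m; rewrite oddM /= andNb.
split=> [[K /sum_degree_split KP]|le_corner].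
  have KN : #|K| <= N by rewrite (leq_trans (max_card _)) // card_ord.
  rewrite -(leq_add2r ('C(#|K|, 2)).*2) bin2E; apply: leq_trans KP _.
  by rewrite -bin2E -doubleD leq_double sum_leq_corner.
have [K KP] := corner_leq_sum dN; exists K; apply/sum_degree_split.
apply: leq_trans (_ : (corner N degree + 'C(#|K|, 2)).*2 <= _).
  by rewrite -bin2E doubleD leq_add2r.
by rewrite leq_double.
Qed.
End SplitDegrees.

(** * Level graphs read off the edge list *)

Lemma level_graph_simple (n : nat) (adj : rel 'I_n) w k i :
  weighted_graph adj w k -> simple_graph (level_graph adj w i).
Proof.
case=> [[irr sym] _ wC _ _]; split=> [x|x y]; rewrite /level_graph ?irr //.
by rewrite sym; case: (boolP (adj y x)) => // /wC ->.
Qed.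

Lemma split_graph_above (n : nat) (adj : rel 'I_n) w k i :
  weighted_graph adj w k -> k < i -> split_graph (level_graph adj w i).
Proof.
move=> [_ _ _ wk _] ki; exists set0; split=> [x y|x y _ _]; first by rewrite inE.
by rewrite /level_graph; apply/andP=> -[/wk]; lia.
Qed.

(** The second endpoint comes first because the program inserts [e.1.1], then [e.1.2], each consed
    onto the list so far. *)
Definition endpoints (es : seq (nat * nat * nat)) : seq nat :=
  flatten [seq [:: e.1.2; e.1.1] | e <- es].

Lemma size_endpoints es : size (endpoints es) = (size es).*2.
Proof. by elim: es => //= e es ->. Qed.

Lemma perm_endpoints es es' : perm_eq es es' -> perm_eq (endpoints es) (endpoints es').
Proof. by move=> ees; apply: perm_flatten; apply: perm_map. Qed.

Definition mult (n : nat) (vs : seq nat) (x : 'I_n) : nat := count_mem (x : nat) vs.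

Section Encoding.
Variables (n : nat) (adj : rel 'I_n) (w : 'I_n -> 'I_n -> nat) (k : nat).
Variable s : seq (nat * nat * nat).
Hypotheses (adj_w : weighted_graph adj w k) (s_adj : encodes adj w s).

Lemma encodes_endpoints : all (gtn n) (endpoints s).
Proof.
apply/allP=> u /flattenP[_ /mapP[[[a b] c] /= abc ->]].
case: s_adj => _ /(_ _ _ _ abc)[x [y [<- <- _ _]]] _.
by rewrite !inE => /pred2P[]->; rewrite ltn_ord.
Qed.

Lemma encodes_weight e : e \in s -> 1 <= e.2 <= size s.
Proof.
(* By surjectivity each of [1, ..., k] is the weight of some record. *)
have k_size : k <= size s.
  rewrite -(size_iota 1 k) -(size_map snd s); apply: uniq_leq_size (iota_uniq _ _) _ => i.
  rewrite mem_iota => ik; case: adj_w => _ _ wC _ /(_ i) [|x [y [xy wi]]]; first by lia.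
  case: s_adj => _ s_w /(_ _ _ xy)[c [] cs].
    have [x' [y' [/ord_inj ex /ord_inj ey _ wc]]] := s_w _ _ _ cs.
    by apply/mapP; exists (x : nat, y : nat, c); rewrite //= -wc ex ey wi.
  have [y' [x' [/ord_inj ey /ord_inj ex _ wc]]] := s_w _ _ _ cs.
  by apply/mapP; exists (y : nat, x : nat, c); rewrite //= -wc ex ey -wC // wi.
case: e => -[u v] c /= es; case: s_adj => _ /(_ _ _ _ es)[x [y [_ _ xy <-]]] _.
by case: adj_w => _ _ _ /(_ _ _ xy) /andP[-> /leq_trans->].
Qed.

(** Listing every edge in both orientations gives a duplicate-free list of arcs; those leaving [x]
    correspond to its neighbours. *)
Lemma degree_mult i (x : 'I_n) :
  degree (level_graph adj w i) x = mult (endpoints [seq e <- s | i <= e.2]) x.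
Proof.
set es := [seq e <- s | _].
pose arcs := [seq e.1 | e <- es] ++ [seq (e.1.2, e.1.1) | e <- es].
have [irr sym] := level_graph_simple i adj_w.
have [uniq_s s_w adj_s] := s_adj.
have es_w u v c : (u, v, c) \in es ->
    exists (y z : 'I_n), [/\ y = u :> nat, z = v :> nat & level_graph adj w i y z].
  rewrite mem_filter /= => /andP[ic /s_w[y [z [yu zv yz wc]]]].
  by exists y, z; rewrite /level_graph yz wc.
have uniq_arcs : uniq arcs.
  have uniq_es : uniq (map upair es).
    by apply: subseq_uniq uniq_s; apply: map_subseq; exact: filter_subseq.
  have pairE (e : nat * nat * nat) : upair e = (minn e.1.1 e.1.2, maxn e.1.1 e.1.2).
    by case: e => -[].
  rewrite cat_uniq; apply/and3P; split.
  - apply: (@map_uniq _ _ (fun a => (minn a.1 a.2, maxn a.1 a.2))).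
    by rewrite -map_comp (eq_map (g := upair)).
  (* An arc listed in both orientations comes from records with the same unordered pair, hence from
     a single record, which is then a loop. *)
  - apply/hasPn => _ /mapP[[[u v] c] /= es1 ->]; apply/mapP=> -[[[u' v'] c'] /= es2 [eu ev]].
    have := uniq_es; rewrite (perm_uniq (perm_map _ (perm_to_rem es1))) /=.
    case/andP=> /mapP[]; exists (u', v', c'); last by rewrite /= -eu -ev minnC maxnC.
    rewrite mem_rem_uniq ?(map_uniq uniq_es) // !inE es2 andbT.
    apply/eqP=> -[eu' _ _]; have [y [z [yu zv]]] := es_w _ _ _ es1.
    suff -> : y = z by rewrite irr.
    by apply: ord_inj; rewrite yu zv eu.
  - apply: (@map_uniq _ _ (fun a => (minn a.1 a.2, maxn a.1 a.2))).
    by rewrite -map_comp (eq_map (g := upair)) // => e /=; rewrite pairE minnC maxnC.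
have arcs_level a b : (a, b) \in arcs ->
    exists (y z : 'I_n), [/\ y = a :> nat, z = b :> nat & level_graph adj w i y z].
  rewrite mem_cat => /orP[] /mapP[[[u v] c] /= /es_w[y [z [yu zv yz]]] [-> ->]].
    by exists y, z.
  by exists z, y; rewrite sym.
have arcsP (y : 'I_n) : ((x : nat, y : nat) \in arcs) = level_graph adj w i x y.
  apply/idP/idP=> [/arcs_level[x' [y' [/ord_inj-> /ord_inj->]]] //|].
  move=> /andP[xy ixy]; rewrite mem_cat; apply/orP.
  have [c [] cs] := adj_s _ _ xy; [left|right]; apply/mapP.
    exists (x : nat, y : nat, c); rewrite // mem_filter cs andbT /=.
    by have [x' [y' [/ord_inj-> /ord_inj-> _ <-]]] := s_w _ _ _ cs.
  exists (y : nat, x : nat, c); rewrite // mem_filter cs andbT /=.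
  have [y' [x' [/ord_inj ey /ord_inj ex _ <-]]] := s_w _ _ _ cs.
  by case: adj_w => _ _ wC _ _; rewrite ex ey -wC.
have -> : mult (endpoints es) x = count (fun a => a.1 == x :> nat) arcs.
  rewrite /mult /endpoints /arcs; elim: (es) => //= e r; rewrite !count_cat /= => ->; lia.
rewrite -size_filter -(size_map snd) /degree cardE -(size_map val).
apply: perm_size; apply: uniq_perm.
- by rewrite (map_inj_uniq val_inj) enum_uniq.
- rewrite map_inj_in_uniq ?filter_uniq // => -[a b] [a' b'].
  by rewrite !mem_filter /= => /andP[/eqP-> _] /andP[/eqP-> _] ->.
move=> v; apply/mapP/mapP => [[y]|[[a b]]].
  rewrite mem_enum inE => xy ->; exists (x : nat, y : nat) => //.
  by rewrite mem_filter eqxx arcsP.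
rewrite mem_filter /= => /andP[/eqP-> xb] ->.
have [x' [y [/ord_inj ex <- xy]]] := arcs_level _ _ xb.
by exists y; rewrite // mem_enum inE -ex.
Qed.

Lemma sum_mult i :
  \sum_(x : 'I_n) mult (endpoints [seq e <- s | i <= e.2]) x =
  (size [seq e <- s | i <= e.2]).*2.
Proof.
rewrite -size_endpoints -sum1_size.
have lt_n : all (gtn n) (endpoints [seq e <- s | i <= e.2]).
  apply/allP => u /flattenP[_ /mapP[e /[!mem_filter]/andP[_ es] ->] ue].
  apply: (allP encodes_endpoints); apply/flattenP.
  by exists [:: e.1.2; e.1.1] => //; apply/mapP; exists e.
rewrite /mult; elim: (endpoints _) lt_n => [|u r IHr] /=.
  by rewrite big_nil big1.
move=> /andP[un /IHr {}IHr]; rewrite big_cons big_split /= IHr; congr (_ + _).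
rewrite (bigD1 (Ordinal un)) //= eqxx big1 // => x.
by rewrite -val_eqE eq_sym /= => /negbTE->.
Qed.

Lemma split_level (i N : nat) : n <= N -> (size s).*2 < N ->
  split_graph (level_graph adj w i) <->
  size [seq e <- s | i <= e.2] <=
    corner N (mult (n := n) (endpoints [seq e <- s | i <= e.2])).
Proof.
move=> nN sN; rewrite (split_graph_corner (level_graph_simple i adj_w) nN) => [|x].
  rewrite (eq_bigr _ (fun x _ => degree_mult i x)) sum_mult leq_double.
  by rewrite (eq_corner _ (degree_mult i)).
rewrite degree_mult (leq_ltn_trans _ sN) // (leq_trans (count_size _ _)) //.
by rewrite size_endpoints leq_double size_filter count_size.
Qed.
End Encoding.

(** * Budgeted runs of the machine, and the program *)

Definition reaches (p : seq instr) (t : nat) (st : mstate) (Q : mstate -> Prop) : Prop :=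
  exists2 st', run p t st = Some st' & Q st'.

Lemma reaches_step p t st st1 Q :
  step p st = Some st1 -> reaches p t st1 Q -> reaches p t.+1 st Q.
Proof. by rewrite /reaches /= => ->. Qed.

Lemma reaches_halt p t st Q : step p st = None -> Q st -> reaches p t st Q.
Proof. by move=> haltp Qst; exists st => //; case: t => [|t] /=; rewrite haltp. Qed.

(** [run] returns as soon as the machine halts, so [t] is only an upper bound on the number of
    steps. *)
Lemma reaches_leq p t t' st Q : t <= t' -> reaches p t st Q -> reaches p t' st Q.
Proof.
elim: t t' st => [|t IHt] [|t'] st //= tt' [st' /=].
  by case E: step => // -[<-] Qst; exists st => //=; rewrite E.
case E: step => [st1|] => [run_t Qst|[<-] Qst]; last by exists st => //=; rewrite E.
by have [||st2] := IHt t' st1; [|exists st'|move=> ??; exists st2 => //=; rewrite E].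
Qed.

Lemma reaches_imp p t st (Q Q' : mstate -> Prop) :
  (forall st', Q st' -> Q' st') -> reaches p t st Q -> reaches p t st Q'.
Proof. by move=> QQ' [st' run_t /QQ' Q'st]; exists st'. Qed.

(* Registers: R1 = 1, R3 = number of edges, later the current weight, R4 = address of the
   current endpoint, R6, R7, R8 = base addresses of the bucket heads, of the degrees and
   of the numbers of vertices of degree at least [j], R9 = number of inserted edges,
   R10 = [corner] of the current degrees; R5, R11, R12, R13 are scratch.
   The cell holding the weight of an edge becomes the link to the next edge of its bucket;
   links are addresses of first endpoints, and 0 is the null link. *)

(* Truncated subtraction makes [1 - (1 - x)] the indicator of [0 < x]. *)
Definition bump_code : seq instr :=
  [:: ILoad 11 4; IAdd 11 11 7; ILoad 12 11; IAdd 12 12 1; IStore 11 12;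
      IAdd 11 8 12; ILoad 13 11; ISub 5 12 13; ISub 5 1 5; ISub 5 1 5;
      IAdd 10 10 5; IAdd 13 13 1; IStore 11 13; IAdd 4 4 1].

Definition split_code : seq instr :=
  [:: IConst 1 1; ILoad 3 1; ILoad 2 0; IAdd 6 3 3; IAdd 6 6 3; IConst 4 2;
      IAdd 6 6 4; IAdd 7 6 3; IAdd 7 7 1; IAdd 8 7 2]
  ++ (* 10: bucket sort; comments give the addresses of jump targets *)
  [:: ISub 5 6 4; IJz 5 21; IAdd 12 4 1; IAdd 12 12 1; ILoad 11 12; IAdd 11 11 6;
      ILoad 5 11; IStore 12 5; IStore 11 4; IAdd 4 12 1; IJmp 10]
  ++ (* 21: next weight, downwards *)
  [:: IJz 3 61; IAdd 4 6 3; ILoad 4 4]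
  ++ (* 24: next edge of the bucket *)
  [:: IJz 4 56; IAdd 9 9 1] ++ bump_code ++ bump_code ++ [:: ILoad 4 4; IJmp 24]
  ++ (* 56: bucket exhausted, split test *)
  [:: ISub 5 9 10; IJz 5 59; IHalt; ISub 3 3 1; IJmp 21]
  ++ (* 61 *)
  [:: IConst 0 1; IHalt].

Ltac exec := apply: reaches_step; [reflexivity|rewrite /upd /=].

(* The linked list from address [p] holds [es], all its records being among the first [i]. *)
Fixpoint chain (i : nat) (M : nat -> nat) (p : nat) (es : seq (nat * nat * nat)) : Prop :=
  if es is e :: es' then
    exists j, [/\ j < i, p = 2 + 3 * j, M p = e.1.1, M p.+1 = e.1.2 & chain i M (M p.+2) es']
  else p = 0.

Lemma chain_frame i i' M M' p es : i <= i' ->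
    (forall b, b < 2 + 3 * i -> M' b = M b) -> chain i M p es -> chain i' M' p es.
Proof.
move=> ii' MM'; elim: es p => //= e es IHes p [j [ji pj Mp Mp1 ch]].
by exists j; split; rewrite ?MM' //; [lia|lia|lia|apply: IHes|lia].
Qed.

Lemma mult_cons n v vs (x : 'I_n) : mult (v :: vs) x = mult vs x + (x == v :> nat).
Proof. by rewrite /mult /= addnC eq_sym. Qed.

(** * Correctness and running time of the program *)

Section Code.
Variables (n : nat) (s : seq (nat * nat * nat)).
Let m := size s.
(** The input ends just below [H], the bucket heads are [H + 1, ..., H + m], and degrees start at
    [D]. The counts at [C] come last, as their index [j] is not bounded in [counters]. *)
Let H := 3 * m + 2.
Let D := H + m + 1.
Let C := D + n.

Definition layout (R : nat -> nat) : Prop :=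
  [/\ R 0 = 0, R 1 = 1, R 6 = H, R 7 = D & R 8 = C].

Definition counters (M : nat -> nat) (vs : seq nat) : Prop :=
  (forall x : 'I_n, M (D + x) = mult vs x) /\
  (forall j, 0 < j -> M (C + j) = num_ge (@mult n vs) j).

(** 26 and 40 are the addresses of the two copies of [bump_code], which has 14 instructions. The
    rest of the run is passed as a continuation, so that budgets add up. *)
Lemma bump_exec N a t R M vs v Q :
    a = 26 \/ a = 40 -> layout R -> counters M vs ->
    R 10 = corner N (@mult n vs) -> M (R 4) = v -> v < n -> (size vs).+1 < N ->
    (forall R' M', layout R' -> counters M' (v :: vs) -> (forall b, b < D -> M' b = M b) ->
      R' 10 = corner N (@mult n (v :: vs)) -> R' 3 = R 3 -> R' 4 = (R 4).+1 ->
      R' 9 = R 9 -> reaches split_code t (MState (a + 14) R' M') Q) ->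
  reaches split_code (14 + t) (MState a R M) Q.
Proof.
move=> aP [R0 R1 R6 R7 R8] [Mdeg Mcnt] R10 R4 vn vsN HQ.
pose x := Ordinal vn; set d := mult vs x; set q := num_ge (@mult n vs) d.+1.
have dN : d.+1 < N by apply: leq_ltn_trans vsN; rewrite ltnS count_size.
have multE y : mult (v :: vs) y = mult vs y + (y == x) by rewrite mult_cons.
have cornerE := corner_bump dN multE; have num_geE := num_ge_bump _ multE.
have Dv : M (D + v) = d by exact: Mdeg x.
have Cd : M (C + d.+1) = q by rewrite Mcnt.
have CD : (C + d.+1 == D + v) = false by rewrite /C; lia.
have last_step R' M' : R' 0 = 0 -> R' 1 = 1 -> R' 6 = H -> R' 7 = D -> R' 8 = C ->
    R' 10 = R 10 + (1 - (1 - (d.+1 - q))) -> R' 3 = R 3 -> R' 4 = R 4 + 1 -> R' 9 = R 9 ->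
    (forall b, M' b = if b == C + d.+1 then q + 1 else if b == D + v then d.+1 else M b) ->
  reaches split_code t (MState (a + 14) R' M') Q.
  move=> R'0 R'1 R'6 R'7 R'8 R'10 R'3 R'4 R'9 M'E; apply: HQ; rewrite ?R'4 ?addn1 //.
  - split=> [y|j j0]; rewrite M'E.
      rewrite multE -Mdeg -val_eqE /= eqn_add2l.
      have -> : (D + y == C + d.+1) = false by have := ltn_ord y; rewrite /C; lia.
      by case: eqVneq => [->|_]; rewrite ?Dv; lia.
    rewrite num_geE -Mcnt // eqn_add2l -/d.
    have -> : (C + j == D + v) = false by rewrite /C; lia.
    by case: eqVneq => [->|_]; rewrite ?Cd; lia.
  - by move=> b bD; rewrite M'E; do 2 (case: eqP => [|_]; first by rewrite /C; lia).
  - by rewrite cornerE R'10 R10 -/d -/q; lia.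
(* [M1] is the memory after the degree is written, [M2] after the count is. For each copy, the new
   corner and the new memory remain to be checked. *)
case: aP => -> in last_step *; do 5 exec; set M1 := (X in MState _ _ X);
  do 8 exec; set M2 := (X in MState _ _ X); exec; apply: last_step; rewrite //= ?R1 //.
- by rewrite {M2}/M1 R4 R7 R8 R1 (addnC v) Dv addn1 CD Cd.
- by move=> b; rewrite /M2 /M1 R4 R7 R8 R1 (addnC v) Dv !addn1 CD Cd.
- by rewrite {M2}/M1 R4 R7 R8 R1 (addnC v) Dv addn1 CD Cd.
- by move=> b; rewrite /M2 /M1 R4 R7 R8 R1 (addnC v) Dv !addn1 CD Cd.
Qed.

Variable N : nat.
Hypothesis ends_s : all (gtn n) (endpoints s).
Hypothesis weights_s : forall e, e \in s -> 1 <= e.2 <= m.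
Hypothesis sN : m.*2 < N.

Definition tally (R M : nat -> nat) (es : seq (nat * nat * nat)) : Prop :=
  [/\ layout R, counters M (endpoints es), R 9 = size es &
      R 10 = corner N (@mult n (endpoints es))].

(** An edge costs 2 + 14 + 14 + 2 instructions, and the exit test 1. The two bumps advance [R 4]
    onto the link cell, and writing only from [D] on keeps the list intact. *)
Lemma inner_exec t es es0 R M Q :
    tally R M es0 -> chain m M (R 4) es -> all (gtn n) (endpoints es) ->
    (size es + size es0) <= m ->
    (forall R' M', tally R' M' (catrev es es0) -> (forall b, b < D -> M' b = M b) ->
      R' 3 = R 3 -> reaches split_code t (MState 56 R' M') Q) ->
  reaches split_code (32 * size es + 1 + t) (MState 24 R M) Q.
Proof.
elim: es es0 R M => [|e es IHes] es0 R M tl /=.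
  move=> R4 _ _ HQ; rewrite muln0 add0n; exec; rewrite R4 /=.
  exact: HQ.
case: tl => [Rl Mc R9 R10] [j [jm R4 Mu Mv ch]] /and3P[vn un en] size_m HQ.
have pD : (R 4).+2 < D by rewrite R4 /D /H; lia.
have -> : 32 * (size es).+1 + 1 + t = (14 + (14 + (32 * size es + 1 + t).+2)).+2 by lia.
have [_ R1 _ _ _] := Rl.
have size_N : (size (endpoints es0)).+2 < N by rewrite size_endpoints; lia.
have R4n0 : (R 4 == 0) = false by rewrite R4.
exec; rewrite R4n0 /=; exec.
apply: (bump_exec (N := N) (v := e.1.1) (vs := endpoints es0)) => //=; [by left|lia|].
move=> R' M' R'l M'c M'D R'10 R'3 R'4 R'9.
apply: (bump_exec (N := N) (v := e.1.2) (vs := e.1.1 :: endpoints es0)) => //=;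
  [by right|by rewrite R'4 M'D; lia|].
move=> R2 M2 R2l M2c M2D R2_10 R2_3 R2_4 R2_9.
have M2E b : b < D -> M2 b = M b by move=> bD; rewrite M2D ?M'D.
exec; exec; apply: (IHes (e :: es0)) => //=; last 1 first.
- move=> R3 M3 tl3 M3D R3_3; apply: HQ => [//|b bD|]; first by rewrite M3D ?M2E.
  by rewrite R3_3 /= R2_3.
- by split; rewrite //= R2_9 R'9 R9 R1 addn1.
- rewrite R2_4 R'4 M2E //; apply: chain_frame ch => // b bm.
  by rewrite M2E // /D /H; lia.
- by lia.
Qed.

(** Records are pushed at the head of their list, hence [rev]. *)
Definition bucket (i c : nat) := rev [seq e <- take i s | e.2 == c].

Definition heads (i : nat) (M : nat -> nat) : Prop :=
  forall c, 1 <= c <= m -> chain i M (M (H + c)) (bucket i c).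

Definition level_test (c : nat) : bool :=
  size [seq e <- s | c <= e.2] <=
    corner N (@mult n (endpoints [seq e <- s | c <= e.2])).

(** Acceptance covers only levels up to [c], those still to be tested when the loop is entered at
    weight [c]; a rejection may come from any level. *)
Definition verdict (c : nat) (st : mstate) : Prop :=
  (regs st 0 = 1 /\ forall i, 1 <= i <= c -> level_test i) \/
  (regs st 0 = 0 /\ exists2 i, 1 <= i <= m & ~~ level_test i).

Lemma perm_bucket c es : perm_eq es [seq e <- s | c < e.2] ->
  perm_eq (catrev (bucket m c) es) [seq e <- s | c <= e.2].
Proof.
move=> es_s; rewrite catrevE /bucket revK take_size.
apply: perm_trans (perm_cat (perm_refl _) es_s) _; apply/permP => P.
rewrite count_cat !count_filter; elim: (s) => //= e r IHr.
by rewrite addnACA IHr; case: (P e) => //=; lia.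
Qed.

Lemma level_test_perm c es : perm_eq es [seq e <- s | c <= e.2] ->
  level_test c = (size es <= corner N (@mult n (endpoints es))).
Proof.
move=> es_s; rewrite /level_test -(perm_size es_s); congr (_ <= _).
by apply: eq_corner => x; apply/permP; rewrite perm_sym perm_endpoints.
Qed.

(** Amortised cost: 8 instructions per remaining weight, 32 per edge not yet inserted, and 2 for the
    exit. *)
Lemma outer_exec c es R M : c <= m -> tally R M es -> R 3 = c -> heads m M ->
    perm_eq es [seq e <- s | c < e.2] ->
  reaches split_code (8 * c + 32 * (m - size es) + 2) (MState 21 R M) (verdict c).
Proof.
elim: c es R M => [|c IHc] es R M cm tl R3 hM es_s.
  apply: (@reaches_leq _ 2); first by lia.
  exec; rewrite R3 /=; exec; apply: reaches_halt => //; left; split=> //= i; lia.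
have es'_s := perm_bucket es_s; set es' := catrev _ _ in es'_s.
have size_es' : size es' = size (bucket m c.+1) + size es.
  by rewrite /es' catrevE size_cat size_rev.
have es'_m : size es' <= m by rewrite (perm_size es'_s) size_filter count_size.
have [[R0 R1 R6 R7 R8] Mc R9 R10] := tl.
apply: (@reaches_leq _
  (32 * size (bucket m c.+1) + 1 + (8 * c + 32 * (m - size es') + 2).+4).+3).
  by lia.
exec; rewrite R3 /=; exec; exec; rewrite R6 R3.
apply: (inner_exec (es0 := es) (es := bucket m c.+1)) => //=;
  [by apply: hM; lia| |by rewrite -size_es'|].
  apply/allP => u /flattenP[us /mapP[e es_e ->] ue].
  apply: (allP ends_s); apply/flattenP; exists [:: e.1.2; e.1.1] => //.
  apply/mapP; exists e => //; move: es_e; rewrite mem_rev mem_filter => /andP[_].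
  exact: mem_take.
move=> R' M' [R'l M'c R'9 R'10] M'D /= R'3; have [R'0 R'1 _ _ _] := R'l.
have testE : (R' 9 - R' 10 == 0) = level_test c.+1.
  by rewrite subn_eq0 R'9 R'10 (level_test_perm es'_s).
exec; apply: reaches_step; first by reflexivity.
rewrite /= testE; case: ifP => test_c; last first.
  apply: reaches_halt => //; right; split=> //; exists c.+1; [lia|exact: negbT].
exec; exec.
apply: (@reaches_imp _ _ _ (verdict c)) => [st [[st0 ok_st]|rej]|]; last 1 first.
- apply: IHc es'_s => //=; first exact: ltnW.
    by rewrite R'3 R3 R'1 subn1.
  move=> i im; rewrite M'D; last by rewrite /D; lia.
  apply: chain_frame (hM i im) => // b bm.
  by rewrite M'D // /D /H; lia.
- left; split=> // i /andP[i0]; rewrite leq_eqVlt ltnS => /predU1P[->|ic] //.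
  by apply: ok_st; rewrite i0.
- by right.
Qed.

(** Weights survive only from record [i] on, the earlier weight cells having become links. The zeros
    are the initial degrees and counts. *)
Definition bucketed (i : nat) (M : nat -> nat) : Prop :=
  [/\ forall j, j < m ->
        M (2 + 3 * j) = (nth (0, 0, 0) s j).1.1 /\ M (3 + 3 * j) = (nth (0, 0, 0) s j).1.2,
      forall j, i <= j < m -> M (4 + 3 * j) = (nth (0, 0, 0) s j).2,
      heads i M &
      forall b, H + m < b -> M b = 0].

Lemma bucket_exec t k i R M Q : i + k = m -> layout R -> R 3 = m -> R 4 = 2 + 3 * i ->
    R 9 = 0 -> R 10 = 0 -> bucketed i M ->
    (forall R' M', tally R' M' [::] -> R' 3 = m -> heads m M' ->
      reaches split_code t (MState 21 R' M') Q) ->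
  reaches split_code (11 * k + 2 + t) (MState 10 R M) Q.
Proof.
elim: k i R M => [|k IHk] i R M ik Rl R3 R4 R9 R10 [M_uv M_c M_h M_0] HQ.
  have R64 : (R 6 - R 4 == 0) by case: Rl => _ _ -> _ _; rewrite R4 /H; lia.
  rewrite muln0 add0n; exec; apply: reaches_step; first by reflexivity.
  rewrite /= R64; rewrite addn0 in ik; subst i; apply: HQ => //.
  (* Positivity matters: [num_ge] at 0 counts all [n] vertices. *)
  have num_ge0 j : 0 < j -> num_ge (@mult n [::]) j = 0.
    by move=> j0; apply: eq_card0 => x; rewrite inE /mult /= leqNgt j0.
  split=> //=; last first.
    rewrite R10 /corner big_nat_cond big1 // => j /andP[/andP[j0 _] _].
    by rewrite num_ge0 // min0n.
  by split=> [x|j j0]; rewrite ?num_ge0 // M_0 //; rewrite /C /D; lia.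
have R64 : (R 6 - R 4 == 0) = false by case: Rl => _ _ -> _ _; rewrite R4 /H; lia.
have [R0 R1 R6 R7 R8] := Rl.
have -> : 11 * k.+1 + 2 + t = 11 + (11 * k + 2 + t) by lia.
exec; apply: reaches_step; first by reflexivity.
(* [M1] turns the weight cell into a link to the old head; [M2] makes this record the new head. *)
rewrite /= R64; do 6 exec; set M1 := (X in MState _ _ X).
exec; set M2 := (X in MState _ _ X); exec; exec.
set e := nth (0, 0, 0) s i in M_c *.
have im : i < m by lia.
have e_m : 1 <= e.2 <= m by apply: weights_s; apply: mem_nth.
have M_e : M (4 + 3 * i) = e.2 by rewrite M_c // leqnn.
have bucketS c : bucket i.+1 c = if e.2 == c then e :: bucket i c else bucket i c.
  rewrite /bucket (take_nth (0, 0, 0) im) filter_rcons -/e.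
  by case: ifP => _; rewrite ?rev_rcons.
have M2E b : M2 b = if b == H + e.2 then 2 + 3 * i else
                    if b == 4 + 3 * i then M (H + e.2) else M b.
  have R4E : R 4 + R 1 + R 1 = 4 + 3 * i by rewrite R4 R1; lia.
  by rewrite /M2 /M1 R4E M_e R6 R4 (addnC e.2).
have M2_lt b : b < 4 + 3 * i -> M2 b = M b.
  by move=> bi; rewrite M2E; do 2 (case: eqP => [|_]; first by rewrite /H; lia).
apply: (IHk i.+1) => //=; [by lia|by rewrite R4 R1; lia|split].
- move=> j jm; have [<- <-] := M_uv j jm; rewrite !M2E.
  by split; do 2 (case: eqP => [|_]; first by rewrite /H; lia).
- move=> j ij; rewrite -M_c; last by lia.
  by rewrite M2E; do 2 (case: eqP => [|_]; first by rewrite /H; lia).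
- move=> c cm; have frame b : b < 2 + 3 * i -> M2 b = M b by move=> bi; apply: M2_lt; lia.
  rewrite bucketS M2E eqn_add2l eq_sym; case: eqVneq => [<-|_].
    have [Mu Mv] := M_uv i im; exists i.
    split=> //; [by rewrite M2_lt //; lia|by rewrite M2_lt //; lia|].
    have -> : (2 + 3 * i).+2 = 4 + 3 * i by lia.
    rewrite M2E eqxx; case: eqP => [|_]; first by rewrite /H; lia.
    by apply: chain_frame (M_h _ e_m).
  case: eqP => [|_]; first by rewrite /H; lia.
  by apply: chain_frame (M_h _ cm).
- move=> b bm; rewrite M2E; do 2 (case: eqP => [|_]; first by rewrite /H; lia).
  exact: M_0.
Qed.

Lemma split_code_correct :
  reaches split_code (60 * (n + m + 1)) (init_state n s) (verdict m).
Proof.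
have input_uv j r : j < m -> r < 3 -> input_mem n s (2 + r + 3 * j) =
    nth 0 [:: (nth (0, 0, 0) s j).1.1; (nth (0, 0, 0) s j).1.2; (nth (0, 0, 0) s j).2] r.
  move=> jm r3; rewrite /input_mem.
  have -> : 2 + r + 3 * j - 2 = j * 3 + r by lia.
  rewrite divnMDl // modnMDl divn_small // addn0 jm modn_small //.
  by case: (nth _ s j) => [[u v] c]; case: r r3 => [|[|[]]].
have input0 b : H <= b -> input_mem n s b = 0.
  move=> Hb; rewrite /input_mem; have b2 : 1 < b by move: Hb; rewrite /H; lia.
  rewrite (gtn_eqF b2) (gtn_eqF (ltnW b2)) ifF //; apply/negbTE; rewrite -leqNgt leq_divRL //.
  by move: Hb; rewrite /H /m; lia.
(* Set-up, bucket sort and main loop: [51 * m + 14] steps in all. *)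
apply: (@reaches_leq _ (10 + (11 * m + 2 + (8 * m + 32 * m + 2)))); first by lia.
have M0 : input_mem n s 0 = n by [].
have M1 : input_mem n s 1 = m by [].
rewrite /init_state; do 10 exec; rewrite -/m.
apply: (bucket_exec (i := 0)) => //.
- by split=> //=; rewrite ?M0 /C /D /H; lia.
- split=> [j jm|j jm|c cm|b bm].
  + by rewrite (input_uv j 0 jm) // (input_uv j 1 jm).
  + by rewrite (input_uv j 2 jm).
  + by rewrite /= input0 ?leq_addr // /bucket take0.
  + by rewrite input0 // (leq_trans _ (ltnW bm)) // leq_addr.
move=> R M tl R3 hM.
rewrite -[m in 32 * m]subn0; apply: (@outer_exec _ [::]) => //.
apply/permP => P; rewrite count_filter; apply/esym/eqP; rewrite -leqn0 leqNgt -has_count.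
by apply/hasPn => e /weights_s /=; lia.
Qed.
End Code.

Theorem theorem4p4 :
  exists (p : seq instr) (c : nat),
    forall (n : nat) (adj : rel 'I_n) (w : 'I_n -> 'I_n -> nat) (k : nat)
           (s : seq (nat * nat * nat)),
      weighted_graph adj w k -> encodes adj w s ->
      exists st : mstate,
        run p (c * (n + size s + 1)) (init_state n s) = Some st /\
        (level_split adj w k -> regs st 0 = 1) /\
        (~ level_split adj w k -> regs st 0 = 0).
Proof.
exists split_code, 60 => n adj w k s adj_w s_adj.
pose N := n + (size s).*2 + 1.
have sN : (size s).*2 < N by rewrite /N; lia.
have nN : n <= N by rewrite /N; lia.
have weights_s := encodes_weight adj_w s_adj.
have testP i : split_graph (level_graph adj w i) <-> level_test n s N i.
  exact: (split_level adj_w s_adj i nN sN).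
have [st run_st st_ok] := split_code_correct (encodes_endpoints s_adj) weights_s sN.
exists st; split=> //.
(* The program tests levels [1] to [|E|] instead of [1] to [k + 1]; the two ranges differ only in
   edgeless levels, which are split and pass the test. *)
case: st_ok => [[st1 ok]|[st0 [i i_m bad]]]; rewrite ?st1 ?st0; split=> //.
  move=> []; rewrite /level_split => i /andP[i0 _]; have [i_m|m_i] := leqP i (size s).
    by apply/testP; apply: ok; rewrite i0.
  apply/testP; rewrite /level_test (_ : [seq e <- s | _] = [::]) //.
  rewrite -(filter_pred0 s); apply: eq_in_filter => e /weights_s /=; lia.
move=> split_w; case/negP: bad; apply/testP.
have [i_k|k_i] := leqP i k; last exact: split_graph_above adj_w k_i.
by apply: split_w; lia.
Qed.
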